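(* If $n$, $m$, $l$ are integers with $0\le 2m\le l\le n-m$, then $h_n(m,l)\le \binom{n}{m}-\binom{n}{m-1}$.
   Context: For integers $0\le m\le l\le n$, the truncated Boolean lattice $\mathcal{B}_n(m,l)$ is the poset, ordered by inclusion, of all subsets of $[n]=\{1,\dots,n\}$ of size at least $m$ and at most $l$. A maximal chain of $\mathcal{B}_n(m,l)$ is a chain $A_m\subset A_{m+1}\subset\cdots\subset A_l$ with $|A_i|=i$ for each $i$. A cutset in $\mathcal{B}_n(m,l)$ is a family $\mathcal{C}\subseteq\mathcal{B}_n(m,l)$ meeting every maximal chain. The width of a family of sets is the size of its largest antichain. $h_n(m,l)$ denotes the minimum width of a cutset in $\mathcal{B}_n(m,l)$. Binomial coefficients with negative lower index are $0$. *)

(* Defs.v *)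
From mathcomp Require Import all_boot all_order all_algebra.

Set Implicit Arguments.
Unset Strict Implicit.
Unset Printing Implicit Defensive.

(* The ground set [n] = {1, ..., n} is rendered as 'I_n = {0, ..., n - 1}. *)
Definition truncB (n m l : nat) : {set {set 'I_n}} :=
  [set A : {set 'I_n} | m <= #|A| <= l].

(* The tuple lists A_m, A_{m+1}, ..., A_l, so its item of index i is A_{m+i};
   for l < m the type of tuples is meaningless, as l - m is truncated. *)
Definition max_chain (n m l : nat) (s : (l - m).+1.-tuple {set 'I_n}) : bool :=
  sorted (fun A B : {set 'I_n} => A \proper B) s
  && [forall i : 'I_(l - m).+1, #|tnth s i| == m + i].

Definition cutset (n m l : nat) (C : {set {set 'I_n}}) : bool :=
  (C \subset truncB n m l)
  && [forall s : (l - m).+1.-tuple {set 'I_n},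
        max_chain s ==> [exists A in C, A \in s]].

Definition antichain (n : nat) (F : {set {set 'I_n}}) : bool :=
  [forall A in F, forall B in F, (A \subset B) ==> (A == B)].

Definition width (n : nat) (C : {set {set 'I_n}}) : nat :=
  \max_(F : {set {set 'I_n}} | (F \subset C) && antichain F) #|F|.

(* The whole poset only seeds the minimization: see truncB_cutset and hP. *)
Definition h (n m l : nat) : nat :=
  width [arg min_(C < truncB n m l | cutset m l C) width C].

Definition binz (n : nat) (k : int) : nat :=
  if k is Posz j then 'C(n, j) else 0.

Lemma truncB_cutset (n m l : nat) : m <= l -> cutset m l (truncB n m l).
Proof.
move=> le_ml; apply/andP; split=> //.
apply/forallP=> s; apply/implyP=> /andP[_ /forallP hs].
apply/existsP; exists (tnth s ord0); rewrite mem_tnth andbT inE.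
by rewrite (eqP (hs ord0)) addn0 leqnn.
Qed.

Lemma hP (n m l : nat) : m <= l ->
  (exists2 C : {set {set 'I_n}}, cutset m l C & width C = h n m l) /\
  (forall C : {set {set 'I_n}}, cutset m l C -> h n m l <= width C).
Proof.
move=> /(truncB_cutset n) cutB; rewrite /h.
by case: arg_minnP => // C cutC minC; split=> //; exists C.
Qed.

(* Main.v *)
(* Let D_A(t) = 2 |A \cap [t]| - t ([height]).  The cutset is the union of the layers C_j,
   0 <= j <= m ([layer j]), of the sets A of size m + j such that D_A has maximum exactly j
   on [0, 2m - j].  A maximal chain that avoids C_0, ..., C_j contains a set of
   size m + j whose D exceeds j before time 2m - j; since D(t) <= t, this is
   impossible for j = m.  Removing from A in C_(j+1) the element at which D_A
   first reaches its maximum on [0, 2m - j - 1] gives an injection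
   C_(j+1) -> C_j: the removed element is read off the image as the last time
   the maximum is attained.  Hence the cutset is covered by |C_0| chains.
   The inverse of this operation, used on [0, n], sends the sets of size m - 1
   injectively to sets of size m outside C_0. *)
Require Import Defs.
From mathcomp Require Import all_boot all_order all_algebra.
From mathcomp Require Import zify.

Set Implicit Arguments.
Unset Strict Implicit.
Unset Printing Implicit Defensive.

(** * Sets as lattice paths with unit steps *)

Section Height.

Variable n : nat.
Implicit Types (A B : {set 'I_n}) (x y : 'I_n).

Definition height A (t : nat) : int :=
  (Posz (2 * #|[set x in A | (x < t)%N]|)%N - Posz t)%R.

Lemma height0 A : height A 0 = 0%R.
Proof.
rewrite /height (_ : [set x in A | x < 0] = set0) ?cards0 //.
by apply/setP=> x; rewrite !inE andbF.
Qed.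

Lemma height_le_card A t : (height A t <= Posz (2 * #|A|) - Posz t)%R.
Proof.
suff: #|[set x in A | x < t]| <= #|A| by rewrite /height; lia.
by apply/subset_leq_card/subsetP=> x; rewrite inE => /andP[].
Qed.

Lemma height_n A : height A n = (Posz (2 * #|A|)%N - Posz n)%R.
Proof.
rewrite /height (_ : [set x in A | x < n] = A) //.
by apply/setP=> x; rewrite inE ltn_ord andbT.
Qed.

Lemma height_subset A B t : A \subset B -> (height A t <= height B t)%R.
Proof.
move=> sAB; suff: #|[set x in A | x < t]| <= #|[set x in B | x < t]|.
  by rewrite /height; lia.
apply/subset_leq_card/subsetP=> x; rewrite !inE => /andP[xA ->].
by rewrite (subsetP sAB).
Qed.

Lemma height_succ A x :
  height A x.+1 = (height A x + (if x \in A then 1 else -1))%R.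
Proof.
have [xA|xNA] := ifP; rewrite /height.
  rewrite (_ : [set y in A | y < x.+1] = x |: [set y in A | y < x]).
    by rewrite cardsU1 !inE ltnn andbF /=; lia.
  apply/setP=> y; rewrite !inE ltnS leq_eqVlt -val_eqE /=.
  by case: eqP => [/val_inj->|]; rewrite ?xA.
rewrite (_ : [set y in A | y < x.+1] = [set y in A | y < x]); first by lia.
apply/setP=> y; rewrite !inE ltnS leq_eqVlt.
by case: eqP => [/val_inj->|]; rewrite ?xNA.
Qed.

Lemma height_step A t :
  height A t.+1 = (height A t + 1)%R \/ height A t.+1 = (height A t - 1)%R.
Proof.
have [lt_tn|le_nt] := ltnP t n.
  by have := height_succ A (Ordinal lt_tn); case: ifP => _ /=; auto.
right; rewrite /height.
rewrite (_ : [set x in A | x < t.+1] = [set x in A | x < t]); first by lia.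
by apply/setP=> x; rewrite !inE !(leq_trans (ltn_ord x)) // leqW.
Qed.

Lemma height_setU1 B x t : x \notin B ->
  height (x |: B) t = (height B t + (if (x < t)%N then 2 else 0))%R.
Proof.
move=> xNB; rewrite /height; have [lt_xt|le_tx] := ltnP.
  rewrite (_ : [set y in x |: B | y < t] = x |: [set y in B | y < t]).
    by rewrite cardsU1 inE (negPf xNB) /=; lia.
  apply/setP=> y; rewrite !inE.
  by have [->|] := eqVneq y x; rewrite ?lt_xt.
rewrite (_ : [set y in x |: B | y < t] = [set y in B | y < t]); first by lia.
apply/setP=> y; rewrite !inE.
by have [->|_] := eqVneq y x; [rewrite [x < t]ltnNge le_tx !andbF|].
Qed.

(** A path with unit steps from height 0 arrives at a level [k > 0] for the first time by an up
    step, that is, at an element of [A]; past [n] it only descends. *)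
Lemma height_first_hit A t k : (0 < k)%R -> (k <= height A t)%R ->
  exists x : 'I_n, [/\ x < t, x \in A, height A x.+1 = k
    & forall s, s <= x -> (height A s < k)%R].
Proof.
move=> k_gt0 le_kt; have exP : exists t, (k <= height A t)%R by exists t.
case: (ex_minnP exP) => [[|u]]; first by rewrite height0; lia.
move=> le_ku min_u; have low s : s <= u -> (height A s < k)%R.
  by move=> le_su; rewrite Order.TotalTheory.ltNge; apply/negP=> /min_u; lia.
have lt_ut := min_u _ le_kt; have := low u (leqnn u) => lt_uk.
have [lt_un|le_nu] := ltnP u n; last first.
  suff eq_s : [set x in A | x < u.+1] = [set x in A | x < u].
    by move: le_ku lt_uk; rewrite /height eq_s; lia.
  by apply/setP=> x; rewrite !inE !(leq_trans (ltn_ord x)) // leqW.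
have := height_succ A (Ordinal lt_un) => /=.
case: ifP => xA eq_u; last by lia.
by exists (Ordinal lt_un); split=> //=; lia.
Qed.

(** * Last maxima and insertion of an element there *)

(* The element [x] is also read as the time just before its own step. *)
Definition last_peak T B x : bool :=
  [forall s : 'I_T.+1, if s <= x then (height B s <= height B x)%R
                       else (height B s < height B x)%R].

Lemma last_peakP T B x : x < T ->
  reflect ((forall s, s <= x -> (height B s <= height B x)%R)
           /\ (forall s, x < s <= T -> (height B s < height B x)%R))
    (last_peak T B x).
Proof.
move=> lt_xT; apply: (iffP forallP) => [peak|[le_x gt_x] s].
  have peakT s : s <= T -> if s <= x then (height B s <= height B x)%R
                       else (height B s < height B x)%R.
    by move=> le_sT; have := peak (inord s); rewrite inordK.
  split=> s; first by move=> le_sx; have := peakT s; rewrite le_sx; apply; lia.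
  by case/andP=> lt_xs /peakT; rewrite leqNgt lt_xs.
by case: leqP => [/le_x //|lt_xs]; apply: gt_x; rewrite lt_xs -ltnS ltn_ord.
Qed.

Lemma last_peak_inj T B x y : x < T -> y < T ->
  last_peak T B x -> last_peak T B y -> x = y.
Proof.
move=> xT yT /(last_peakP _ xT)[le_x gt_x] /(last_peakP _ yT)[le_y gt_y].
apply: val_inj; case: (ltngtP x y) => // [lt|lt].
  by have := gt_x y; have := le_y x; rewrite lt /=; lia.
by have := gt_y x; have := le_x y; rewrite lt /=; lia.
Qed.

(** The height of [x |: B1] first reaches its maximum on [0, T] just after [x], so the union
    determines [x]. In the proof, [x < y] gives [height B1 x + 1 = height B2 x.+1 <= height B2 y =
    height B1 y.+1 + 1], against the peak of [B1] at [x]. *)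
Lemma last_peak_setU1_inj T B1 B2 x y : x < T -> y < T ->
  x \notin B1 -> y \notin B2 -> last_peak T B1 x -> last_peak T B2 y ->
  x |: B1 = y |: B2 -> B1 = B2.
Proof.
wlog le_xy : B1 B2 x y / x <= y => [wl|].
  move=> *; case: (leqP x y) => [le|/ltnW le]; first exact: (wl _ _ _ _ le).
  by apply/esym/(wl _ _ y x).
move=> xT yT xB yB /(last_peakP _ xT)[le_x gt_x] /(last_peakP _ yT)[le_y gt_y].
move=> eqA; have [eq_xy|/eqP ne_xy] := eqVneq x y.
  by rewrite -(setU1K xB) -(setU1K yB) eqA eq_xy.
have lt_xy : x < y by move/eqP: ne_xy; rewrite -val_eqE /=; lia.
have hA s : (height B1 s + (if (x < s)%N then 2 else 0)
             = height B2 s + (if (y < s)%N then 2 else 0))%R.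
  by rewrite -!height_setU1 // eqA.
have := gt_x y.+1; have := le_y x.+1; have := hA x.+1; have := hA y.+1.
have := hA y; have := height_succ B1 x; have := height_succ B2 y.
rewrite (negPf xB) (negPf yB) !ltnS !leqnn lt_xy (ltnW lt_xy) ltnn yT /=.
by rewrite [y <= x]leqNgt lt_xy /=; lia.
Qed.

(** The last maximum on [0, n] comes before [n], hence names an element: the path starts at 0 and
    ends below 0. *)
Lemma exists_last_peak B : 2 * #|B| < n -> exists x, last_peak n B x.
Proof.
move=> ltB.
pose P t := (t <= n) && [forall s : 'I_n.+1, (height B s <= height B t)%R].
have exP : exists t, P t.
  have [t _ max_t] :=
    @Order.TotalTheory.arg_maxP _ _ _ (@ord0 n) xpredT (height B) isT.
  by exists t; rewrite /P -ltnS ltn_ord; apply/forallP=> s; apply: max_t.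
have ubP t : P t -> t <= n by case/andP.
case: (ex_maxnP exP ubP) => t /andP[le_tn /forallP max_t] last_t.
have max_n s : s <= n -> (height B s <= height B t)%R.
  by move=> le_sn; have := max_t (inord s); rewrite inordK.
have lt_tn : t < n.
  rewrite ltn_neqAle le_tn andbT; apply/eqP=> eq_tn.
  by have := max_n 0 (leq0n n); rewrite height0 eq_tn height_n; lia.
exists (Ordinal lt_tn); apply/last_peakP=> //=; split=> s.
  by move=> le_st; apply: max_n; lia.
case/andP=> lt_ts le_sn; have := max_n s le_sn.
rewrite Order.POrderTheory.le_eqVlt => /orP[/eqP eq_st|//].
suff /last_t : P s by rewrite leqNgt lt_ts.
by rewrite /P le_sn; apply/forallP=> u; rewrite eq_st.
Qed.

Lemma last_peak_ge0 T B x : x < T -> last_peak T B x -> (0 <= height B x)%R.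
Proof. by move=> xT /(last_peakP _ xT)[le_x _]; rewrite -(height0 B) le_x. Qed.

Lemma last_peak_notin T B x : x < T -> last_peak T B x -> x \notin B.
Proof.
move=> xT /(last_peakP _ xT)[_ /(_ x.+1)]; rewrite ltnS leqnn xT => /(_ isT).
by rewrite height_succ; case: ifP => //; lia.
Qed.

End Height.

(** * The layers and the injections between them *)

Section Layers.

Variables n m : nat.
Implicit Types A B : {set 'I_n}.

Definition layer (j : nat) : {set {set 'I_n}} :=
  [set A : {set 'I_n} | [&& #|A| == m + j,
     [forall t : 'I_(2 * m - j).+1, (height A t <= Posz j)%R]
   & [exists t : 'I_(2 * m - j).+1, height A t == Posz j]]].

Lemma layerP j A :
  reflect [/\ #|A| = m + j,
     forall t, t <= 2 * m - j -> (height A t <= Posz j)%R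
   & exists2 t, t <= 2 * m - j & height A t = Posz j]
   (A \in layer j).
Proof.
rewrite inE; apply: (iffP and3P).
  case=> /eqP cA /forallP le_j /existsP[t /eqP eq_t]; split=> //.
    by move=> u le_u; have := le_j (inord u); rewrite inordK.
  by exists t; rewrite // -ltnS ltn_ord.
case=> cA le_j [t le_t eq_t]; split; first exact/eqP.
  by apply/forallP=> u; apply: le_j; rewrite -ltnS ltn_ord.
by apply/existsP; exists (inord t); rewrite inordK // eq_t.
Qed.

(** [x] is the step by which [A] first rises to [j.+1]. Removing it lowers all later heights by 2,
    so the maximum drops to [j] and is last attained just before that step. *)
Lemma layer_down j A : j < m -> A \in layer j.+1 ->
  exists x : 'I_n, [/\ x < 2 * m - j.+1, x \in A, A :\ x \in layer j
    & last_peak (2 * m - j.+1) (A :\ x) x].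
Proof.
move=> lt_jm /layerP[cA le_A [t le_t eq_t]].
have [||x [lt_xt xA eq_x lt_x]] := @height_first_hit n A t (Posz j.+1).
- by lia.
- by lia.
have xNB : x \notin A :\ x by rewrite !inE eqxx.
have hA s : height A s = (height (A :\ x) s + (if (x < s)%N then 2 else 0))%R.
  by rewrite -{1}(setD1K xA) height_setU1.
have xT : x < 2 * m - j.+1 by lia.
have hBx : height (A :\ x) x = Posz j.
  by have := hA x; have := height_succ A x; rewrite xA ltnn; lia.
have lo s : s <= x -> (height (A :\ x) s <= Posz j)%R.
  by move=> le_sx; have := lt_x s le_sx; have := hA s; rewrite ltnNge le_sx /=; lia.
have hi s : x < s <= 2 * m - j.+1 -> (height (A :\ x) s < Posz j)%R.
  by case/andP=> lt_xs le_s; have := le_A s le_s; have := hA s; rewrite lt_xs; lia.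
exists x; split=> //; last by apply/last_peakP=> //; split=> s; rewrite hBx; auto.
apply/layerP; split.
- by have := cardsD1 x A; rewrite xA cA addnS add1n => -[->].
- move=> s le_s; have [/lo//|lt_xs] := leqP s x.
  have [le_s'|gt_s] := leqP s (2 * m - j.+1).
    by have := hi s; rewrite lt_xs le_s' => /(_ isT); lia.
  (* The window of [layer j] has one extra time; one step earlier the height is still below [j]. *)
  have -> : s = (2 * m - j.+1).+1 by lia.
  have := height_step (A :\ x) (2 * m - j.+1).
  by have := hi (2 * m - j.+1); rewrite xT leqnn => /(_ isT); lia.
- by exists x; rewrite ?hBx; lia.
Qed.

(* [3 * m - #|A|] is [2 * m - j] when [#|A| = m + j]. *)
Definition lower A : {set 'I_n} :=
  let T := 3 * m - #|A| in
  if [pick x in A | (x < T) && last_peak T (A :\ x) x] is Some x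
  then A :\ x else A.

Lemma lowerP j A : j < m -> A \in layer j.+1 ->
  exists x : 'I_n, [/\ x < 2 * m - j.+1, x \in A, lower A = A :\ x
    & last_peak (2 * m - j.+1) (A :\ x) x].
Proof.
move=> lt_jm Aj; have /layerP[cA _ _] := Aj.
have eqT : 3 * m - #|A| = 2 * m - j.+1 by lia.
rewrite /lower eqT; case: pickP => [x /and3P[xA xT px]|no]; first by exists x.
by have [x [xT xA _ px]] := layer_down lt_jm Aj; have := no x; rewrite xA xT px.
Qed.

(** The element picked by [lower] need not be visibly the one from [layer_down]; inserting either
    gives back [A], so [last_peak_setU1_inj] identifies the two images. *)
Lemma lower_layer j A : j < m -> A \in layer j.+1 -> lower A \in layer j.
Proof.
move=> lt_jm Aj; have [x [xT xA -> px]] := lowerP lt_jm Aj.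
have [y [yT yA yj py]] := layer_down lt_jm Aj.
suff -> : A :\ x = A :\ y by [].
apply: (last_peak_setU1_inj xT yT _ _ px py); rewrite ?setD11 //.
by rewrite !setD1K.
Qed.

Lemma lower_sub A : lower A \subset A.
Proof. by rewrite /lower; case: pickP => [x _|_]; rewrite ?subD1set. Qed.

Lemma lower_inj j : j < m -> {in layer j.+1 &, injective lower}.
Proof.
move=> lt_jm A B Aj Bj; have [x [xT xA -> px]] := lowerP lt_jm Aj.
have [y [yT yB -> py]] := lowerP lt_jm Bj => eqAB.
have eq_xy : x = y by apply: (last_peak_inj xT yT px); rewrite eqAB.
by rewrite -(setD1K xA) -(setD1K yB) eqAB eq_xy.
Qed.

Lemma card_layer j A : A \in layer j -> #|A| = m + j.
Proof. by case/layerP. Qed.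

Lemma iter_lower_layer j A : j <= m -> A \in layer j -> iter j lower A \in layer 0.
Proof.
elim: j A => // j IH A lt_jm Aj; rewrite iterSr; apply: IH; first exact: ltnW.
exact: lower_layer.
Qed.

(** Repeated lowering takes [A] to a subset in [layer i], which injectivity of [lower] identifies
    with [B]: sets over the same member of [layer 0] form a chain. *)
Lemma iter_lower_sub i j A B : i <= j <= m -> A \in layer j -> B \in layer i ->
  iter j lower A = iter i lower B -> B \subset A.
Proof.
elim: j i A B => [|j IH] i A B /andP[le_ij lt_jm] Aj Bi.
  by move: le_ij; rewrite leqn0 => /eqP-> /= ->.
move: le_ij; rewrite leq_eqVlt => /orP[/eqP eq_i|lt_ij].
  rewrite eq_i !iterSr => eqAB; rewrite eq_i in Bi.
  have lA := lower_layer lt_jm Aj; have lB := lower_layer lt_jm Bi.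
  have jj : j <= j <= m by rewrite leqnn ltnW.
  suff /(lower_inj lt_jm Aj Bi)-> : lower A = lower B by [].
  apply/eqP; rewrite eqEsubset; apply/andP.
  by split; apply: (IH j).
rewrite iterSr => eqAB; apply: subset_trans (lower_sub A).
by apply: (IH i) => //; [rewrite -ltnS lt_ij ltnW | apply: lower_layer].
Qed.

(** * Width of the union of the layers *)

Definition layers : {set {set 'I_n}} := \bigcup_(j < m.+1) layer j.

Lemma layersP A :
  reflect (exists2 j, j <= m & A \in layer j) (A \in layers).
Proof.
apply: (iffP bigcupP) => [[j _ Aj]|[j le_jm Aj]].
  by exists j; rewrite // -ltnS ltn_ord.
by exists (inord j); rewrite // inordK.
Qed.

(** An antichain has at most one set on each chain, so sending a set to the bottom of its chain is
    injective on it. *)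
Lemma width_layers : width layers <= #|layer 0|.
Proof.
apply/bigmax_leqP=> F /andP[/subsetP sF /forall_inP acF].
pose g A := iter (#|A| - m) lower A.
have gE j A : A \in layer j -> g A = iter j lower A.
  by move/card_layer=> cA; rewrite /g cA addKn.
have g_inj : {in F &, injective g}.
  move=> A B AF BF; have /layersP[j le_jm Aj] := sF _ AF.
  have /layersP[i le_im Bi] := sF _ BF; rewrite (gE _ _ Aj) (gE _ _ Bi) => eqg.
  have ac := fun A B AF => forall_inP (acF A AF) B.
  have [le_ij|/ltnW le_ji] := leqP i j.
    apply/esym/eqP; apply: (implyP (ac _ _ BF AF)).
    by apply: iter_lower_sub Aj Bi eqg; rewrite le_ij.
  apply/eqP; apply: (implyP (ac _ _ AF BF)).
  by apply: iter_lower_sub Bi Aj (esym eqg); rewrite le_ji.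
rewrite -(card_in_imset g_inj); apply/subset_leq_card/subsetP=> _ /imsetP[A AF ->].
have /layersP[j le_jm Aj] := sF _ AF.
by rewrite (gE _ _ Aj) iter_lower_layer.
Qed.

(** * Every maximal chain meets a layer *)

(* Sets of size [m + j] that a maximal chain avoiding [layers] can contain. *)
Definition overfull (j : nat) A : bool :=
  [exists t : 'I_(2 * m - j), (Posz j < height A t)%R].

Lemma overfullP j A :
  reflect (exists2 t, t + j < 2 * m & (Posz j < height A t)%R) (overfull j A).
Proof.
apply: (iffP existsP) => [[t gt_t]|[t lt_t gt_t]].
  by exists t => //; have := ltn_ord t; lia.
have lt_t' : t < 2 * m - j by lia.
by exists (Ordinal lt_t').
Qed.

(** Height 0 is attained at the start, so only a positive height can keep [A] out of [layer 0]; the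
    bound [2 * m - t] on heights puts it before time [2 * m]. *)
Lemma overfull0 A : #|A| = m -> A \notin layer 0 -> overfull 0 A.
Proof.
move=> cA; apply: contraR => /overfullP no; apply/layerP; split; rewrite ?addn0 //.
  move=> t _; rewrite Order.TotalTheory.leNgt; apply/negP=> gt_t; apply: no.
  by exists t => //; have := height_le_card A t; lia.
by exists 0; rewrite ?height0.
Qed.

(** Passing to a superset lowers no height, so [B] reaches [j.+1] in its window. Outside
    [layer j.+1] it must then exceed [j.+1], and does so before the last time. *)
Lemma overfull_step j A B : overfull j A -> A \subset B -> #|B| = m + j.+1 ->
  B \notin layer j.+1 -> overfull j.+1 B.
Proof.
case/overfullP=> t lt_t gt_t sAB cB; apply: contraR => /overfullP no.
have hB : (Posz j.+1 <= height B t)%R by have := height_subset t sAB; lia.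
have low s : s + j.+1 < 2 * m -> (height B s <= Posz j.+1)%R.
  move=> lt_s; rewrite Order.TotalTheory.leNgt; apply/negP=> gt_s; apply: no.
  by exists s.
apply/layerP; split=> //; last first.
  have [|x [lt_xt _ eq_x _]] := @height_first_hit n B t (Posz j.+1) _ hB; first by lia.
  by exists x.+1; rewrite ?eq_x; lia.
move=> [|s] le_s; first by rewrite height0; lia.
have := low s; have := low s.+1; have [lt_s|ge_s] := ltnP (s.+1 + j.+1) (2 * m).
  by move=> /(_ isT).
(* at the last time, the height has the parity of [j.+1] *)
have eq_s : s.+1 + j.+1 = 2 * m by lia.
by move=> _ /(_ ltac:(lia)); have := height_step B s; rewrite /height; lia.
Qed.

Lemma overfull_m A : ~~ overfull m A.
Proof.
apply/overfullP; case=> t lt_t; suff : (height A t <= Posz t)%R by lia.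
elim: t {lt_t} => [|t IH]; first by rewrite height0.
by have := height_step A t; lia.
Qed.

(** A chain avoiding all layers would have overfull sets at every size from [m] to [2 * m], a size
    it reaches because [2 * m <= l]; [overfull_m] forbids the last one. *)
Lemma cutset_layers l : 2 * m <= l -> cutset m l layers.
Proof.
move=> le_ml; apply/andP; split.
  apply/subsetP=> A /layersP[j le_jm /card_layer cA].
  by rewrite inE cA; lia.
apply/forallP=> s; apply/implyP=> /andP[srt /forallP card_s].
apply: contraT; rewrite negb_exists_in => /forall_inP avoid.
have size_s : size s = (l - m).+1 by rewrite size_tuple.
have cs i : i <= l - m -> #|nth set0 s i| = m + i.
  by move=> le_i; have := eqP (card_s (inord i)); rewrite (tnth_nth set0) inordK.
have nl i : i <= m -> nth set0 s i \notin layer i.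
  move=> le_im; apply/negP=> si; suff /avoid : nth set0 s i \in layers.
    by rewrite mem_nth // size_s; lia.
  by apply/layersP; exists i.
suff /(_ m (leqnn m)) : forall i, i <= m -> overfull i (nth set0 s i).
  by rewrite (negPf (overfull_m _)).
elim=> [|i IH] le_im.
  by apply: overfull0; [rewrite cs ?addn0; lia | apply: nl].
apply: (overfull_step (IH (ltnW le_im))); [|by apply: cs; lia|exact: nl].
apply: proper_sub; move/(sortedP set0): srt; apply.
by rewrite size_s; lia.
Qed.

(** * Counting the bottom layer *)

Definition lift_peak B : {set 'I_n} :=
  if [pick x | last_peak n B x] is Some x then x |: B else B.

Lemma lift_peakP B : 2 * #|B| < n ->
  exists2 x : 'I_n, last_peak n B x & lift_peak B = x |: B.
Proof.
move=> /exists_last_peak[x0 p0]; rewrite /lift_peak.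
by case: pickP => [x px|/(_ x0)]; [exists x | rewrite p0].
Qed.

(** Inserting the last peak creates a positive height, so the lifted sets of size [m.-1] are sets of
    size [m] outside [layer 0]. *)
Lemma card_layer0 : 0 < m -> 2 * m <= n -> #|layer 0| + 'C(n, m.-1) <= 'C(n, m).
Proof.
move=> m_gt0 le_mn; pose sets k := [set A : {set 'I_n} | #|A| == k].
have card_sets k : #|sets k| = 'C(n, k) by rewrite card_draws card_ord.
have ltB B : B \in sets m.-1 -> 2 * #|B| < n by rewrite inE => /eqP->; lia.
have inj : {in sets m.-1 &, injective lift_peak}.
  move=> B1 B2 /ltB/lift_peakP[x px ->] /ltB/lift_peakP[y py ->].
  apply: (last_peak_setU1_inj (ltn_ord x) (ltn_ord y) _ _ px py).
    exact: last_peak_notin (ltn_ord x) px.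
  exact: last_peak_notin (ltn_ord y) py.
rewrite -!card_sets -(card_in_imset inj).
have sub0 : layer 0 \subset sets m.
  by apply/subsetP=> A /card_layer; rewrite addn0 inE => ->.
have subL : lift_peak @: sets m.-1 \subset sets m :\: layer 0.
  apply/subsetP=> _ /imsetP[B Bm ->]; have [x px ->] := lift_peakP (ltB B Bm).
  have xNB := last_peak_notin (ltn_ord x) px.
  have cB : #|x |: B| = m.
    by move: Bm; rewrite inE cardsU1 xNB => /eqP->; lia.
  rewrite in_setD [X in _ && X]inE cB eqxx andbT; apply/negP=> /layerP[_ le0 _].
  (* The height at [x.+1] is positive and at most [2 * m - x.+1], so this time lies in the window
     where [le0] applies. *)
  have := height_setU1 x.+1 xNB; have := height_succ B x.
  have := last_peak_ge0 (ltn_ord x) px; have := height_le_card (x |: B) x.+1.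
  by rewrite (negPf xNB) ltnS leqnn cB; have := le0 x.+1; lia.
rewrite -(cardsID (layer 0) (sets m)) (setIidPr sub0) leq_add2l.
exact: subset_leq_card.
Qed.

End Layers.

Theorem theorem3 (n m l : nat) (h2ml : 2 * m <= l) (hlnm : l + m <= n) :
  (Posz (h n m l) <= Posz (binz n (Posz m)) - Posz (binz n (Posz m - 1)))%R.
Proof.
have le_ml : m <= l by lia.
have [_ /(_ _ (@cutset_layers n m l h2ml)) le_h] := hP n le_ml.
have {le_h} le_h0 := leq_trans le_h (width_layers n m).
have [m0|m_gt0] := posnP m; last first.
  have -> : (Posz m - 1 = Posz m.-1)%R by lia.
  have le_mn : 2 * m <= n by lia.
  by rewrite /binz; have := card_layer0 m_gt0 le_mn; lia.
(* [Negz 0] is -1, where [binz] vanishes; the only candidate for [layer 0] is the empty set. *)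
subst m; have -> : (Posz 0 - 1 = Negz 0)%R by [].
suff : #|layer n 0 0| <= 'C(n, 0) by rewrite /binz bin0; lia.
rewrite -[X in 'C(X, 0)]card_ord -card_draws.
by apply/subset_leq_card/subsetP=> A /card_layer cA; rewrite inE cA.
Qed.
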